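(* Let $\kappa$ be an infinite cardinal and assume there is a free, $\sigma$-complete ideal $J$ on $\kappa$ such that player TWO has a winning tactic in the game $G^+(J)$. Then each points ${\sf G}_\delta$ indestructibly Lindelöf space has cardinality less than $\kappa$.
   Context: A set $J\subseteq\mathcal{P}(\kappa)$ is a free ideal on $\kappa$ if: (i) each finite subset of $\kappa$ is in $J$; (ii) $\kappa\notin J$; (iii) the union of any two elements of $J$ is in $J$; (iv) if $B\in J$ then $\mathcal{P}(B)\subseteq J$. $J^+=\{A\in\mathcal{P}(\kappa): A\notin J\}$. $J$ is $\sigma$-complete if the union of every countable subfamily of $J$ is in $J$. Game $G^+(J)$: players ONE and TWO play one inning for each finite ordinal $n$. In inning $n$, ONE first chooses $O_n\in J^+$, and TWO responds with $T_n\in J^+$, subject to the rule $O_{n+1}\subseteq T_n\subseteq O_n$ for every $n$. TWO wins the play if $\bigcap_{n<\omega}T_n\in J^+$; otherwise ONE wins. A winning tactic for TWO is a winning strategy for TWO which depends only on the most recent move of ONE, i.e. a function $\sigma:J^+\to J^+$ with $\sigma(O)\subseteq O$ such that TWO wins every play in which $T_n=\sigma(O_n)$ for all $n$. A points ${\sf G}_\delta$ space is a topological space in which each singleton is a ${\sf G}_\delta$ set. A space is Lindelöf if each open cover has a countable subcover. A Lindelöf space is indestructibly Lindelöf (indestructible) if it remains Lindelöf (with the topology generated by its ground-model open sets) after forcing with any countably closed forcing notion. *)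

(* Defs.v *)
From mathcomp Require Import all_boot all_order.
From mathcomp Require Import boolp classical_sets functions cardinality.
From mathcomp Require Import topology borel_hierarchy.

Set Implicit Arguments.
Unset Strict Implicit.
Unset Printing Implicit Defensive.

Local Open Scope classical_set_scope.

(** * Ideals and the game G^+(J) *)

Section Ideals.
Variable K : Type.
Implicit Types (J : set (set K)) (sigma : set K -> set K).

Record free_ideal J : Prop := FreeIdeal {
  ideal_finite : forall A, finite_set A -> J A ;
  ideal_proper : ~ J setT ;
  ideal_setU : forall A B, J A -> J B -> J (A `|` B) ;
  ideal_subset : forall A B, J B -> A `<=` B -> J A }.

Definition sigma_complete J : Prop :=
  forall F : set (set K), F `<=` J -> countable F -> J (\bigcup_(A in F) A).

Definition positive J : set (set K) := ~` J.

Definition play J (O T : nat -> set K) : Prop :=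
  [/\ forall n, positive J (O n), forall n, positive J (T n),
      forall n, T n `<=` O n & forall n, O n.+1 `<=` T n].

Definition TWO_wins J (T : nat -> set K) : Prop := positive J (\bigcap_n T n).

(* A tactic is a function from J^+ to J^+; the values of sigma outside J^+ are
   irrelevant. *)
Definition winning_tactic J sigma : Prop :=
  (forall O, positive J O -> positive J (sigma O) /\ sigma O `<=` O) /\
  (forall O T, play J O T -> (forall n, T n = sigma (O n)) -> TWO_wins J T).

End Ideals.

(** * Topological notions *)

Definition points_Gdelta (X : topologicalType) : Prop :=
  forall x : X, Gdelta [set x].

Definition lindelof (X : topologicalType) : Prop :=
  forall U : set (set X), U `<=` open -> \bigcup_(A in U) A = setT ->
  exists V : set (set X),
    [/\ V `<=` U, countable V & \bigcup_(A in V) A = setT].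

(** * Forcing *)

Record forcing_notion := ForcingNotion {
  condition :> Type ;
  stronger : condition -> condition -> Prop ;
  weakest : condition ;
  stronger_refl : forall p, stronger p p ;
  stronger_trans : forall p q r, stronger p q -> stronger q r -> stronger p r ;
  stronger_weakest : forall p, stronger p weakest }.

Arguments weakest {_}.

Notation "p ⪯ q" := (stronger p q) (at level 70, no associativity).

Definition countably_closed (P : forcing_notion) : Prop :=
  forall p : nat -> P, (forall n, p n.+1 ⪯ p n) ->
  exists q : P, forall n, q ⪯ p n.

(* The forcing relation is given by its usual recursive clauses, as a shallow
   embedding: a sentence [phi] of the forcing language is represented by the set
   of the conditions that force it, so that [phi p] reads "p forces phi". *)
Section ForcingRelation.
Variable P : forcing_notion.

Definition sentence := P -> Prop.

Definition dense_below (p : P) (D : set P) : Prop :=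
  forall q, q ⪯ p -> exists2 r, r ⪯ q & D r.

Definition f_and (phi psi : sentence) : sentence := fun p => phi p /\ psi p.

Definition f_imp (phi psi : sentence) : sentence :=
  fun p => forall q, q ⪯ p -> phi q -> psi q.

(* T is either a type of names, or a type of ground-model objects identified
   with their canonical (check) names. *)
Definition f_all (T : Type) (phi : T -> sentence) : sentence :=
  fun p => forall t, phi t p.

Definition f_ex (T : Type) (D : set T) (phi : T -> sentence) : sentence :=
  fun p => dense_below p [set q | exists2 t, D t & phi t q].

(* A P-name is a set of pairs (name, condition).  [name X], for a type X of
   ground-model objects, is the type of the names all of whose elements are
   pairs (check x, p): each subset of X in the generic extension has such a
   name.  Likewise each family of subsets of X in the extension has a name in
   [name (name X)]. *)
Definition name (T : Type) : Type := set (T * P).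

Variable X : Type.
Implicit Types (x : X) (A B : name X) (U V : name (name X)).

Definition check (S : set X) : name X :=
  [set xp | S xp.1 /\ xp.2 = weakest].

Definition f_in x A : sentence :=
  fun p => dense_below p [set q | exists2 r, A (x, r) & q ⪯ r].

Definition f_subset A B : sentence :=
  f_all (fun x => f_imp (f_in x A) (f_in x B)).

Definition f_eq A B : sentence := f_and (f_subset A B) (f_subset B A).

Definition f_mem A U : sentence :=
  fun p => dense_below p
    [set q | exists B, exists2 r, U (B, r) & q ⪯ r /\ f_eq A B q].

Definition f_subfamily V U : sentence :=
  f_all (fun A : name X => f_imp (f_mem A V) (f_mem A U)).

Definition f_cover U : sentence :=
  f_all (fun x => f_ex setT (fun A : name X => f_and (f_mem A U) (f_in x A))).

(* "There is an omega-sequence of subsets of X whose range includes V".  Such a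
   sequence is a subset of omega * X in the extension, hence has a name in
   [name (nat * X)], which is written here in the curried form
   [nat -> name X]. *)
Definition f_countable V : sentence :=
  f_ex setT (fun W : nat -> name X =>
    f_all (fun A : name X =>
      f_imp (f_mem A V) (f_ex setT (fun n : nat => f_eq A (W n))))).

End ForcingRelation.

(* The sentence "X, with the topology generated by the ground-model open sets,
   is Lindelof".  The family of the ground-model open sets is still closed under
   finite intersections in the extension, so it is a base of the topology it
   generates. *)
Section ForcedLindelof.
Variables (P : forcing_notion) (X : topologicalType).

Definition f_open (A : name P X) : sentence P :=
  f_all (fun x : X => f_imp (f_in x A)
    (f_ex (@open X) (fun S : set X =>
      f_and (f_in x (check S)) (f_subset (check S) A)))).

Definition f_lindelof : sentence P :=
  f_all (fun U : name P (name P X) =>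
    f_imp
      (f_and (f_all (fun A : name P X => f_imp (f_mem A U) (f_open A)))
             (f_cover U))
      (f_ex setT (fun V : name P (name P X) =>
         f_and (f_subfamily V U) (f_and (f_countable V) (f_cover V))))).

End ForcedLindelof.

Definition indestructibly_lindelof (X : topologicalType) : Prop :=
  lindelof X /\
  forall P : forcing_notion, countably_closed P -> f_lindelof X (@weakest P).

(* Main.v *)
Require Import Defs.
From mathcomp Require Import all_boot all_order.
From mathcomp Require Import boolp classical_sets functions cardinality.
From mathcomp Require Import topology borel_hierarchy.

Set Implicit Arguments.
Unset Strict Implicit.
Unset Printing Implicit Defensive.

Local Open Scope classical_set_scope.
Local Open Scope card_scope.

(** Suppose that |X| < kappa fails.  Cardinals being comparable, there is an
injection f : K -> X.  Order the J-positive sets by Q <= O when Q is contained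
in sigma O (or Q = O).  A strictly descending sequence in this order is a run
of ONE's moves against the tactic sigma, and since sigma wins, the intersection
of TWO's answers is a lower bound: the order is a countably closed notion of
forcing ([tactic_forcing_closed]).

A generic filter G for this order behaves like an ultrafilter extending the dual
of J.  In the extension let C be the family of the ground-model open sets S such
that some condition in G, transported by f, misses S.  It covers X: a point x is
the intersection of countably many open sets S n, and since J is
sigma-complete and contains the points, below any condition Q one of the sets
Q minus the preimage of S n is positive ([forced_cover]).  But C has no
countable subcover.  Countably closed forcing adds no new sequences, so a single
condition Q can decide all the members S n of a would-be countable subcover and
be disjoint, through f, from all of them; but Q, being positive, has an element,
whose image is then not covered ([forced_no_countable_subcover]).  So X does not
remain Lindelof. *)

(** * Comparability of cardinals *)

Lemma injection_card_le (A B : Type) (f : A -> B) :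
  injective f -> [set: A] #<= [set: B].
Proof.
move=> f_inj; have fA : f @` setT #= [set: A].
  by apply: inj_card_eq => x y _ _; apply: f_inj.
move: fA; rewrite card_eq_le => /andP[_ le_A].
exact: card_le_trans le_A (card_leT _).
Qed.

(** A maximal partial bijection, regarded as a set of pairs, is total on one
side or on the other: otherwise one more pair could be added. *)
Lemma injection_comparable (A B : Type) :
  (exists f : A -> B, injective f) \/ (exists g : B -> A, injective g).
Proof.
pose partial_bij (G : set (A * B)) := forall a b a' b',
  G (a, b) -> G (a', b') -> a = a' <-> b = b'.
have [F FP Ftot|G [Gbij Gmax]] := @Zorn_bigcup _ partial_bij.
  move=> a b a' b' [G FG Gab] [G' FG' Gab'].
  have [sub|sub] := Ftot _ _ FG FG'.
    by apply: (FP _ FG') => //; apply: sub.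
  by apply: (FP _ FG) => //; apply: sub.
have [domG|/existsNP[a aG]] := pselect (forall a, exists b, G (a, b)).
  have [f fG] := choice domG; left; exists f => a a' eq_f.
  by apply/(Gbij _ _ _ _ (fG a) (fG a')).
have [codG|/existsNP[b bG]] := pselect (forall b, exists a, G (a, b)).
  have [g gG] := choice codG; right; exists g => b b' eq_g.
  by apply/(Gbij _ _ _ _ (gG b) (gG b')).
have/Gmax[] : G `<` G `|` [set (a, b)].
  split=> [|sub]; first exact: subsetUl.
  by apply: aG; exists b; apply: sub; right.
move=> x y x' y' [Gxy|[-> ->]] [Gxy'|[-> ->]] //.
- exact: Gbij.
- by split=> e; [case: aG; exists y; rewrite -e|case: bG; exists x; rewrite -e].
- by split=> e; [case: aG; exists y'; rewrite e|case: bG; exists x'; rewrite e].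
Qed.

Lemma card_le_injection (A B : Type) :
  [set: A] #<= [set: B] -> exists f : A -> B, injective f.
Proof.
move=> /card_leP[g]; exists (fun a => val (g (to_setT a))) => a a' /val_inj.
have a_in x : to_setT x \in [set: [set: A]] by rewrite inE.
by move=> /('inj_g (a_in a) (a_in a')) [].
Qed.

(** * Forcing with a countably closed notion *)

Lemma f_subset_stronger (P : forcing_notion) (T : Type) (A B : name P T) p q :
  q ⪯ p -> f_subset A B p -> f_subset A B q.
Proof. by move=> qp AB x r rq; apply: AB; apply: stronger_trans qp. Qed.

Lemma f_mem_stronger (P : forcing_notion) (T : Type) (A : name P T) U p q :
  q ⪯ p -> f_mem A U p -> f_mem A U q.
Proof. by move=> qp AU r rq; apply: AU; apply: stronger_trans qp. Qed.

Lemma f_in_check (P : forcing_notion) (T : Type) (S : set T) x (p : P) :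
  S x -> f_in x (@check P T S) p.
Proof.
move=> Sx q _; exists q; first exact: stronger_refl.
by exists weakest; [|exact: stronger_weakest].
Qed.

Lemma f_in_checkP (P : forcing_notion) (T : Type) (S : set T) x (p : P) :
  f_in x (@check P T S) p -> S x.
Proof. by move=> /(_ p (stronger_refl p))[q _ [r []]]. Qed.

Lemma descending_stronger (P : forcing_notion) (p : nat -> P) :
  (forall n, p n.+1 ⪯ p n) -> forall m n, m <= n -> p n ⪯ p m.
Proof.
move=> p_desc m n /subnKC <-; elim: (n - m) => [|k IH].
  by rewrite addn0; apply: stronger_refl.
by rewrite addnS; apply: stronger_trans IH.
Qed.

(** Descending through the dense sets one after the other yields a sequence, of
which countable closure provides a lower bound.  This is the form in which
countably closed forcing adds no new sequences. *)
Lemma countably_closed_dense (P : forcing_notion) (p : P) (D : nat -> set P) :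
  countably_closed P -> (forall n, dense_below p (D n)) ->
  exists2 q, q ⪯ p & forall n, exists2 r, q ⪯ r & D n r.
Proof.
move=> Pclosed Ddense.
have /choice[step stepP] (nq : nat * P) :
    exists r, nq.2 ⪯ p -> r ⪯ nq.2 /\ D nq.1 r.
  case: nq => n q /=; have [qp|nqp] := pselect (q ⪯ p).
    by have [r rq Dr] := Ddense n q qp; exists r.
  by exists q.
pose s := fix s n := if n is m.+1 then step (m, s m) else p.
have sp n : s n ⪯ p.
  elim: n => [|n /= IH]; first exact: stronger_refl.
  by have [s_le _] := stepP (n, s n) IH; apply: stronger_trans IH.
have [|q qs] := Pclosed s; first by move=> n; have [] := stepP (n, s n) (sp n).
exists q; first exact: (qs 0).
move=> n; exists (s n.+1); first exact: qs.
by have [] := stepP (n, s n) (sp n).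
Qed.

(** * Forcing with positive sets, ordered by a tactic *)

Section TacticForcing.
Variables (K : Type) (J : set (set K)) (sigma : set K -> set K).
Hypotheses (J_ideal : free_ideal J) (sigma_wins : winning_tactic J sigma).

Let sigma_positive O : positive J O -> positive J (sigma O).
Proof. by move=> /sigma_wins.1[]. Qed.

Let sigma_sub O : positive J O -> sigma O `<=` O.
Proof. by move=> /sigma_wins.1[]. Qed.

Lemma positive_nonempty A : positive J A -> A !=set0.
Proof.
move=> Apos; apply/set0P/eqP => A0; apply: Apos; rewrite A0.
exact: ideal_finite.
Qed.

Definition positive_set := {O : set K | positive J O}.

(** The first clause makes the whole space the weakest condition; a positive set
need not be contained in sigma setT. *)
Definition tactic_le (Q O : positive_set) : Prop :=
  [\/ sval O = setT, Q = O | sval Q `<=` sigma (sval O)].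

Lemma tactic_le_sub Q O : tactic_le Q O -> sval Q `<=` sval O.
Proof.
case=> [->//|->//|QO]; apply: subset_trans QO _.
by apply: sigma_sub; apply: svalP.
Qed.

Lemma tactic_le_refl O : tactic_le O O.
Proof. exact: Or32. Qed.

Lemma tactic_le_trans R Q O : tactic_le R Q -> tactic_le Q O -> tactic_le R O.
Proof.
move=> RQ; case=> [OT|<-//|QO]; first exact: Or31.
by apply: Or33; apply: subset_trans QO; apply: tactic_le_sub.
Qed.

Definition tactic_forcing : forcing_notion :=
  @ForcingNotion positive_set tactic_le (exist _ setT (ideal_proper J_ideal))
    tactic_le_refl tactic_le_trans (fun Q => Or31 _ _ erefl).

Lemma positive_sigma_stronger (Q : tactic_forcing) A (Apos : positive J A) :
  A `<=` sigma (sval Q) -> (exist _ A Apos : tactic_forcing) ⪯ Q.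
Proof. exact: Or33. Qed.

(** A descending sequence that is not eventually constant has a subsequence
whose terms are moves of ONE against the tactic; the intersection of the
answers is positive, and lies in every answer. *)
Lemma tactic_forcing_closed : countably_closed tactic_forcing.
Proof.
move=> p p_desc; have p_le := descending_stronger p_desc.
have [[N pN]|moving] :=
    pselect (exists N, forall n, N <= n -> p n = p N).
  exists (p N) => n; have [nN|/ltnW Nn] := leqP n N; first exact: p_le.
  by rewrite pN //; apply: stronger_refl.
have next N : exists n, N <= n /\ p n <> p N.
  apply: contrapT => noN; apply: moving; exists N => n Nn.
  by apply: contrapT => np; apply: noN; exists n.
(* Beyond M the weakest condition does not occur, so that p n <= p m with
   p n <> p m means that p n is contained in sigma (p m). *)
have [M MT] : exists M, sval (p M) <> setT.
  apply: contrapT => allT; have [n [_]] := next 0; apply.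
  have isT m : sval (p m) = setT by apply: contrapT => mT; apply: allT; exists m.
  move: (isT n) (isT 0); case: (p n) (p 0) => [A Apos] [B Bpos] /= AT BT.
  by apply: eq_exist; rewrite AT.
have [g gP] := choice next.
pose i := fix i n := if n is m.+1 then g (i m) else M.
have i_next n : i n <= i n.+1 by have [] := gP (i n).
have Mi n : M <= i n.
  by elim: n => [|n IH] //; apply: leq_trans IH (i_next n).
have iT n : sval (p (i n)) <> setT.
  move=> e; apply: MT; apply/seteqP; split=> // k _.
  by apply: (tactic_le_sub (p_le _ _ (Mi n))); rewrite e.
have i_sigma n : sval (p (i n.+1)) `<=` sigma (sval (p (i n))).
  have [le_i ne_i] := gP (i n).
  by have [/iT[]|/ne_i[]|] := p_le _ _ le_i.
pose O n := sval (p (i n)); pose T n := sigma (O n).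
have Opos n : positive J (O n) by apply: svalP.
have Tpos : positive J (\bigcap_n T n).
  by apply: (sigma_wins.2 O T) => //; split=> // n;
    [apply: sigma_positive|apply: sigma_sub].
have i_ge n : n <= i n.
  elim: n => [|n IH] //; apply: leq_ltn_trans IH _.
  rewrite ltn_neqAle i_next andbT; apply/eqP => e.
  by have [_ []] := gP (i n); rewrite -[g _]/(i n.+1) -e.
exists (exist _ _ Tpos) => n.
apply: stronger_trans (p_le _ _ (i_ge n)).
by apply: positive_sigma_stronger => k; apply.
Qed.

(** * Destroying the Lindelof property *)

Section ForcedCover.
Variables (X : topologicalType) (f : K -> X).
Hypothesis f_inj : injective f.

(** A name for the family of the open sets S whose complement contains the image
under f of some condition in the generic filter. *)
Definition missed_open_sets : name tactic_forcing (name tactic_forcing X) :=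
  [set Ap | exists S, [/\ open S, Ap.1 = check S &
    sval Ap.2 `<=` f @^-1` (~` S)]].

Lemma forced_open A (p : tactic_forcing) :
  f_mem A missed_open_sets p -> f_open A p.
Proof.
move=> AU x q qp xA r rq.
have [s sr [B [t [S [/= S_open -> _]] [_ [AS SA]]]]] :=
  AU r (stronger_trans rq qp).
exists s => //; exists S => //; split; last exact: SA.
by apply: AS (stronger_refl s) _ => u us; apply: xA;
  apply: stronger_trans rq; apply: stronger_trans sr.
Qed.

(** Let the open sets S n have intersection [set x].  Were all the sets sigma q
minus the preimage of S n in J, then sigma q would be in J, being covered by
them and the preimage of x, which is finite.  So one of these sets is positive;
it is a condition below q which puts S n into the family. *)
Lemma forced_cover (p : tactic_forcing) :
  sigma_complete J -> points_Gdelta X -> f_cover missed_open_sets p.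
Proof.
move=> J_sigma X_Gdelta x q _; have [S S_open xS] := X_Gdelta x.
pose R n := sigma (sval q) `\` f @^-1` (S n).
have [n Rpos] : exists n, positive J (R n).
  apply: contrapT => noR; apply: (sigma_positive (svalP q)).
  have RJ n : J (R n) by apply: contrapT => Rn; apply: noR; exists n.
  apply: (@ideal_subset _ _ J_ideal _
    (f @^-1` [set x] `|` \bigcup_(A in range R) A)).
    apply: (ideal_setU J_ideal).
      apply: (ideal_finite J_ideal); apply: finite_preimage => //.
      by move=> k l _ _; apply: f_inj.
    apply: J_sigma; first by move=> _ [n _ <-].
    exact: card_image_le.
  move=> k qk; have [fk|] := pselect ([set x] (f k)); first by left.
  rewrite xS => /existsNP[n /not_implyP[_ nS]].
  by right; exists (R n); [exists n|split].
exists (exist _ (R n) Rpos : tactic_forcing).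
  by apply: positive_sigma_stronger => k [].
have Snx : S n x by have: [set x] x by []; rewrite xS; apply.
exists (check (S n)) => //; split; last exact: f_in_check.
move=> r rR; exists r; first exact: stronger_refl.
exists (check (S n)), (exist _ (R n) Rpos).
  by exists (S n); split=> // k [].
by split=> //; split=> y s _.
Qed.

(** Each term W n of a sequence enumerating V can be decided: below any condition
there is one which either forces that W n is not in V, or is disjoint from the
preimage of a set S of the ground model and forces W n to be contained in S.  A
single condition q decides all the terms; the image of a point of q lies in none
of the sets S, so that q cannot force V to cover X. *)
Lemma forced_no_countable_subcover (p : tactic_forcing) V :
  f_subfamily V missed_open_sets p -> f_countable V p -> ~ f_cover V p.
Proof.
move=> VU V_countable V_cover.
have [p1 p1p [W _ VW]] := V_countable p (stronger_refl p).
(* A condition forcing that W n is not in V belongs to D n with S = set0. *)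
pose D n : set tactic_forcing := [set r : tactic_forcing | exists2 S : set X,
  sval r `<=` f @^-1` (~` S) &
  forall A q, q ⪯ r -> f_mem A V q -> f_eq A (W n) q ->
    f_subset A (check S) q].
have D_dense n : dense_below p1 (D n).
  move=> q qp1; have [[A [r [rq AV AW]]]|noA] := pselect (exists A r,
    [/\ r ⪯ q, f_mem A V r & f_eq A (W n) r]).
  - have rp : r ⪯ p by apply: stronger_trans p1p; apply: stronger_trans qp1.
    have [s sr [B [t [S [/= _ -> tS]] [st [AS _]]]]] :=
      VU A r rp AV r (stronger_refl r).
    exists s; first exact: stronger_trans sr rq.
    exists S; first exact: subset_trans (tactic_le_sub st) tS.
    move=> A' u us _ [A'W _] x v vu xA'.
    have vs : v ⪯ s by apply: stronger_trans us.
    have xW : f_in x (W n) v by apply: A'W.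
    exact: AS vs (AW.2 x v (stronger_trans vs sr) xW).
  - exists q; first exact: stronger_refl.
    exists set0 => [k _ []|A r rq AV AW].
    by case: noA; exists A, r.
have [q qp1 q_decides] := countably_closed_dense tactic_forcing_closed D_dense.
have [k qk] := positive_nonempty (svalP q).
have [r rq [A _ [AV kA]]] := V_cover (f k) q (stronger_trans qp1 p1p).
have [s sr [n _ AW]] := VW A r (stronger_trans rq qp1) AV r (stronger_refl r).
have [t qt [S tS A_sub]] := q_decides n.
have st : s ⪯ t by apply: stronger_trans qt; apply: stronger_trans rq.
have kS : f_in (f k) (check S) s.
  apply: (A_sub A s st (f_mem_stronger sr AV) AW) (stronger_refl s) _.
  by move=> u us; apply: kA; apply: stronger_trans sr.
by apply: (tS k (tactic_le_sub qt qk)); apply: f_in_checkP kS.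
Qed.

End ForcedCover.
End TacticForcing.

Theorem theorem4 (K : Type) (K_infinite : infinite_set [set: K])
  (K_ideal : exists J : set (set K),
     [/\ free_ideal J, sigma_complete J &
         exists sigma : set K -> set K, winning_tactic J sigma])
  (X : topologicalType) :
  points_Gdelta X -> indestructibly_lindelof X ->
  [set: X] #<= [set: K] /\ ~ ([set: X] #= [set: K]).
Proof.
move=> X_Gdelta [_ X_indestructible].
have no_inj : ~ exists f : K -> X, injective f.
  move=> [f f_inj]; have [J [J_ideal J_sigma [sigma sigma_wins]]] := K_ideal.
  pose P := tactic_forcing J_ideal sigma_wins.
  have top_refl := stronger_refl (@weakest P).
  pose U : name P (name P X) := missed_open_sets f.
  have [|p _ [V _ [VU [V_countable V_cover]]]] :=
    X_indestructible P (@tactic_forcing_closed _ _ _ J_ideal sigma_wins)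
      U weakest top_refl _ weakest top_refl.
    by split; [move=> A q _; apply: forced_open|apply: forced_cover].
  exact: forced_no_countable_subcover VU V_countable V_cover.
split.
  have [/no_inj[]|[g g_inj]] := injection_comparable K X.
  exact: injection_card_le g_inj.
rewrite card_eq_le => /andP[_ KX]; apply: no_inj.
exact: card_le_injection.
Qed.
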